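(* Let $(\Omega,\mathcal{H},\hat{E})$ be a sublinear expectation space and let $\{Y_i\}_{i=1}^{\infty}$ be a sequence of $\mathbb{R}^d$-valued random variables in it satisfying the following conditions: (i) for every $i\ge1$, $Y_{i+1}$ is independent from $(Y_1,\ldots,Y_i)$; (ii) there exists a constant $M>0$ such that $\hat{E}[|Y_i|^2]\le M$ for all $i\ge1$; (iv) $\{g_i\}$ converges pointwise to a function $g:\mathbb{R}^d\to\mathbb{R}$, i.e. $\lim_{i\to\infty}g_i(p)=g(p)$ for all $p\in\mathbb{R}^d$, where $g_i:\mathbb{R}^d\to\mathbb{R}$, $g_i(p)=\hat{E}[\langle Y_i,p\rangle]$. Let $S_n=Y_1+\cdots+Y_n$. Then $\{S_n/n\}_{n=1}^\infty$ converges in law to the maximal distribution $N(\Gamma;0)$, i.e. $$\lim_{n\to\infty}\hat{E}\left[\varphi\left(\frac{S_n}{n}\right)\right]=\hat{E}[\varphi(\eta)]\quad\text{for all }\varphi\in C_{b,Lip}(\mathbb{R}^d),$$ where $\eta\sim N(\Gamma;0)$ and $\Gamma\subset\mathbb{R}^d$ is the bounded, convex and closed set with $g(p)=\sup_{q\in\Gamma}\langle p,q\rangle$ for all $p\in\mathbb{R}^d$.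
   Context: Sublinear expectation space: $\Omega$ is a set and $\mathcal{H}$ is a linear space of real functions on $\Omega$ containing the constants, closed under $X\mapsto|X|$, and such that $\varphi(X_1,\ldots,X_n)\in\mathcal{H}$ whenever $X_1,\ldots,X_n\in\mathcal{H}$ and $\varphi\in C_{l,Lip}(\mathbb{R}^n)$. Here $C_{l,Lip}(\mathbb{R}^n)$ is the space of $\varphi:\mathbb{R}^n\to\mathbb{R}$ with $|\varphi(x)-\varphi(y)|\le C(1+|x|^m+|y|^m)|x-y|$ for all $x,y$, for some $C>0$, $m\in\mathbb{N}$ depending on $\varphi$; $C_{b,Lip}(\mathbb{R}^n)$ is the space of bounded Lipschitz functions. A sublinear expectation is a functional $\hat{E}:\mathcal{H}\to\mathbb{R}$ that is monotone ($X\ge Y\Rightarrow\hat{E}[X]\ge\hat{E}[Y]$), constant preserving ($\hat{E}[c]=c$), sub-additive ($\hat{E}[X+Y]\le\hat{E}[X]+\hat{E}[Y]$) and positively homogeneous ($\hat{E}[\lambda X]=\lambda\hat{E}[X]$, $\lambda\ge0$). An $\mathbb{R}^d$-valued random variable is an element of $\mathcal{H}^d$. Independence: $Y\in\mathcal{H}^n$ is independent from $X\in\mathcal{H}^m$ if $\hat{E}[\varphi(X,Y)]=\hat{E}\big[\hat{E}[\varphi(x,Y)]|_{x=X}\big]$ for all $\varphi\in C_{l,Lip}(\mathbb{R}^{n+m})$. Maximal distribution: for a (nonempty) bounded, convex and closed $\Gamma\subset\mathbb{R}^d$, a $d$-dimensional random vector $\eta$ is maximal distributed, $\eta\sim N(\Gamma;0)$,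 if $\hat{E}[\varphi(\eta)]=\max_{y\in\Gamma}\varphi(y)$ for all $\varphi\in C_{b,Lip}(\mathbb{R}^d)$. The vector $\eta$ may live on another sublinear expectation space, whose expectation is still denoted $\hat{E}$. *)

(* Defs.v *)
From HB Require Import structures.
From mathcomp Require Import all_boot all_order all_algebra.
From mathcomp Require Import all_classical all_reals all_analysis.

Set Implicit Arguments.
Unset Strict Implicit.
Unset Printing Implicit Defensive.

Import Order.TTheory GRing.Theory Num.Theory.
Import numFieldNormedType.Exports.

Local Open Scope classical_set_scope.
Local Open Scope ring_scope.

Definition dot (R : realType) (n : nat) (x y : 'rV[R]_n) : R :=
  \sum_(j < n) x ord0 j * y ord0 j.

(* The library norm `|x| on 'rV[R]_n is the sup norm; this is the Euclidean
   one. *)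
Definition enorm (R : realType) (n : nat) (x : 'rV[R]_n) : R :=
  Num.sqrt (dot x x).

Definition C_l_Lip (R : realType) (n : nat) (phi : 'rV[R]_n -> R) : Prop :=
  exists (C : R) (m : nat), 0 < C /\
    forall x y, `|phi x - phi y|
      <= C * (1 + enorm x ^+ m + enorm y ^+ m) * enorm (x - y).

Definition C_b_Lip (R : realType) (n : nat) (phi : 'rV[R]_n -> R) : Prop :=
  (exists K : R, forall x, `|phi x| <= K) /\
  (exists L : R, forall x y, `|phi x - phi y| <= L * enorm (x - y)).

(* The expectation is a total function on [carrier -> R], but it is
   constrained only on the space [rv] of random variables; its values
   elsewhere are irrelevant. *)
Record sublinear_space (R : realType) := SublinearSpace {
  carrier : Type;
  rv : set (carrier -> R);
  expect : (carrier -> R) -> R;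
  rv_cst : forall c : R, rv (fun=> c);
  rv_add : forall X Y, rv X -> rv Y -> rv (fun w => X w + Y w);
  rv_scale : forall (a : R) X, rv X -> rv (fun w => a * X w);
  rv_abs : forall X, rv X -> rv (fun w => `|X w|);
  rv_comp : forall (n : nat) (X : 'I_n -> carrier -> R) (phi : 'rV[R]_n -> R),
    (forall i, rv (X i)) -> C_l_Lip phi ->
    rv (fun w => phi (\row_(i < n) X i w));
  expect_mono : forall X Y, rv X -> rv Y ->
    (forall w, Y w <= X w) -> expect Y <= expect X;
  expect_cst : forall c : R, expect (fun=> c) = c;
  expect_subadd : forall X Y, rv X -> rv Y ->
    expect (fun w => X w + Y w) <= expect X + expect Y;
  expect_pos_hom : forall (a : R) X, 0 <= a -> rv X ->
    expect (fun w => a * X w) = a * expect X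
}.

Definition random_vector (R : realType) (S : sublinear_space R) (n : nat)
    (X : carrier S -> 'rV[R]_n) : Prop :=
  forall j : 'I_n, rv (fun w => X w ord0 j).

Definition independent_from (R : realType) (S : sublinear_space R) (n m : nat)
    (Y : carrier S -> 'rV[R]_n) (X : carrier S -> 'rV[R]_m) : Prop :=
  forall phi : 'rV[R]_(m + n) -> R, C_l_Lip phi ->
    expect (fun w => phi (row_mx (X w) (Y w))) =
    expect (fun w => expect (fun w' => phi (row_mx (X w) (Y w')))).

(* The vector (Y 0, ..., Y (i - 1)), flattened into R^(i * d). *)
Definition history (R : realType) (S : sublinear_space R) (d : nat)
    (Y : nat -> carrier S -> 'rV[R]_d) (i : nat) (w : carrier S) :
    'rV[R]_(i * d) :=
  mxvec (\matrix_(k < i, j < d) Y k w ord0 j).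

(* [Gamma] is the (nonempty) bounded, convex and closed set with support
   function [g].  Nonemptiness is needed for the real [sup] to be proper. *)
Definition supported_by (R : realType) (d : nat) (g : 'rV[R]_d -> R)
    (Gamma : set 'rV[R]_d) : Prop :=
  [/\ Gamma !=set0, bounded_set Gamma, convex_set Gamma, closed Gamma &
      forall p, g p = sup [set dot p q | q in Gamma]].

Definition maximal_distributed (R : realType) (T : sublinear_space R) (d : nat)
    (Gamma : set 'rV[R]_d) (eta : carrier T -> 'rV[R]_d) : Prop :=
  random_vector eta /\
  forall phi : 'rV[R]_d -> R, C_b_Lip phi ->
    exists y, [/\ Gamma y, forall z, Gamma z -> phi z <= phi y &
                  expect (fun w => phi (eta w)) = phi y].

(* Main.v *)
(* No PDE is needed.  If [|g_k - g| <= eps |.|] on R^d, expanding the square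
   of [v + Y_k - q] for suitable [q] in [Gamma] shows that the sublinear
   expectation of the squared distance from [S_k] to [k Gamma] grows by at
   most [O(eps k + 1)] at step [k]; it is therefore [o(n^2)], which puts
   [S_n / n] close to [Gamma] and bounds the limit by [max_Gamma phi].
   Conversely, for [y] in [Gamma] the same expansion shows that the lower
   expectation [- E[- |S_n - n y|^2]] is [o(n^2)], which bounds the limit
   below by [phi y].  Finally [Gamma = {q | forall p, <p, q> <= g p}], and
   [g] is its support function by finite-dimensional Hahn-Banach. *)
Require Import Defs.
From HB Require Import structures.
From mathcomp Require Import all_boot all_order all_algebra.
From mathcomp Require Import all_classical all_reals all_analysis.
From mathcomp Require Import ring lra.
Import Order.TTheory GRing.Theory Num.Theory.
Import numFieldNormedType.Exports.
Local Open Scope classical_set_scope.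
Local Open Scope ring_scope.
Set Implicit Arguments.
Unset Strict Implicit.
Unset Printing Implicit Defensive.

(** * Inner product and Euclidean norm on row vectors *)

Section Euclidean.
Variables (R : realType) (n : nat).
Implicit Types (x y z : 'rV[R]_n) (a : R).

Lemma dotC x y : dot x y = dot y x.
Proof. by apply: eq_bigr => j _; rewrite mulrC. Qed.

Lemma dotDl x y z : dot (x + y) z = dot x z + dot y z.
Proof. by rewrite -big_split; apply: eq_bigr => j _; rewrite mxE mulrDl. Qed.

Lemma dotZl a x y : dot (a *: x) y = a * dot x y.
Proof. by rewrite mulr_sumr; apply: eq_bigr => j _; rewrite mxE mulrA. Qed.

Lemma dotNl x y : dot (- x) y = - dot x y.
Proof. by rewrite -scaleN1r dotZl mulN1r. Qed.

Lemma dotBl x y z : dot (x - y) z = dot x z - dot y z.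
Proof. by rewrite dotDl dotNl. Qed.

Lemma dotDr x y z : dot x (y + z) = dot x y + dot x z.
Proof. by rewrite dotC dotDl !(dotC x). Qed.

Lemma dotZr a x y : dot x (a *: y) = a * dot x y.
Proof. by rewrite dotC dotZl (dotC x). Qed.

Lemma dotNr x y : dot x (- y) = - dot x y.
Proof. by rewrite dotC dotNl (dotC x). Qed.

Lemma dotBr x y z : dot x (y - z) = dot x y - dot x z.
Proof. by rewrite dotDr dotNr. Qed.

Lemma dot0l x : dot 0 x = 0.
Proof. by rewrite -(scale0r x) dotZl mul0r. Qed.

Lemma dotxx_ge0 x : 0 <= dot x x.
Proof. by apply: sumr_ge0 => j _; rewrite -expr2 sqr_ge0. Qed.

Lemma enorm_ge0 x : 0 <= enorm x.
Proof. exact: sqrtr_ge0. Qed.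

Lemma sqr_enorm x : enorm x ^+ 2 = dot x x.
Proof. by rewrite sqr_sqrtr ?dotxx_ge0. Qed.

Lemma enorm0 : enorm (0 : 'rV[R]_n) = 0.
Proof. by rewrite /enorm dot0l sqrtr0. Qed.

Lemma coord_le_enorm x j : `|x ord0 j| <= enorm x.
Proof.
rewrite -sqrtr_sqr ler_wsqrtr // /dot (bigD1 j) //= expr2 lerDl.
by apply: sumr_ge0 => k _; rewrite -expr2 sqr_ge0.
Qed.

Lemma enorm_eq0 x : enorm x = 0 -> x = 0.
Proof.
move=> x0; apply/rowP => j; rewrite mxE; apply/eqP.
by rewrite -normr_le0 -x0 coord_le_enorm.
Qed.

Lemma normr_le_enorm x : `|x| <= enorm x.
Proof.
rewrite -[leLHS]/(mx_norm x) mx_normrE; apply/bigmax_leP; split => [|[i j] _] /=.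
  exact: enorm_ge0.
by rewrite (ord1 i) coord_le_enorm.
Qed.

(** Cauchy-Schwarz, by expanding the nonnegative square of [enorm y *: x - enorm x *: y]; the
    degenerate cases go first so that the factor [enorm x * enorm y] can be cancelled. *)
Lemma dot_le x y : dot x y <= enorm x * enorm y.
Proof.
have [x0|xn0] := eqVneq (enorm x) 0.
  by rewrite x0 (enorm_eq0 x0) dot0l mul0r.
have [y0|yn0] := eqVneq (enorm y) 0.
  by rewrite y0 (enorm_eq0 y0) dotC dot0l mulr0.
have x0 : 0 < enorm x by rewrite lt_def xn0 enorm_ge0.
have y0 : 0 < enorm y by rewrite lt_def yn0 enorm_ge0.
have := dotxx_ge0 (enorm y *: x - enorm x *: y).
rewrite !(dotBl, dotBr, dotZl, dotZr) (dotC y x) -!sqr_enorm => H.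
have : 0 <= (enorm x * enorm y) * (enorm x * enorm y - dot x y).
  by move: H; lra.
by rewrite pmulr_rge0 ?mulr_gt0// subr_ge0.
Qed.

Lemma enormD x y : enorm (x + y) <= enorm x + enorm y.
Proof.
rewrite -(@ler_pXn2r _ 2) ?nnegrE ?addr_ge0 ?enorm_ge0//.
rewrite sqr_enorm !(dotDl, dotDr) (dotC y x) -!sqr_enorm.
by have := dot_le x y; lra.
Qed.

Lemma enormZ a x : enorm (a *: x) = `|a| * enorm x.
Proof. by rewrite /enorm dotZl dotZr mulrA -expr2 sqrtrM ?sqr_ge0// sqrtr_sqr. Qed.

Lemma enormN x : enorm (- x) = enorm x.
Proof. by rewrite -scaleN1r enormZ normrN1 mul1r. Qed.

Lemma enormBC x y : enorm (x - y) = enorm (y - x).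
Proof. by rewrite -enormN opprB. Qed.

Lemma enormB x y : enorm (x - y) <= enorm x + enorm y.
Proof. by rewrite -(enormN y) enormD. Qed.

Lemma enorm_sum (I : Type) (r : seq I) (P : pred I) (F : I -> 'rV[R]_n) :
  enorm (\sum_(i <- r | P i) F i) <= \sum_(i <- r | P i) enorm (F i).
Proof.
elim/big_ind2 : _ => // [|x a y b xa yb]; first by rewrite enorm0.
by rewrite (le_trans (enormD _ _)) ?lerD.
Qed.

Lemma dist_enorm x y : `|enorm x - enorm y| <= enorm (x - y).
Proof.
rewrite ler_norml; have := enormD (x - y) y; have := enormD (y - x) x.
by rewrite !subrK (enormBC y); lra.
Qed.

Lemma normr_dot_le x y : `|dot x y| <= enorm x * enorm y.
Proof.
by rewrite ler_norml dot_le lerNl -dotNl -(enormN x) dot_le.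
Qed.

Lemma sqr_enormB x y :
  enorm (x - y) ^+ 2 = enorm x ^+ 2 - 2 * dot x y + enorm y ^+ 2.
Proof. by rewrite !sqr_enorm !(dotBl, dotBr) (dotC y x); lra. Qed.

Lemma sqr_enormD x y :
  enorm (x + y) ^+ 2 = enorm x ^+ 2 + 2 * dot x y + enorm y ^+ 2.
Proof. by rewrite -{1}(opprK y) sqr_enormB dotNr enormN; lra. Qed.

(** Together with [normr_le_enorm], this lets boundedness, closedness and compactness, which refer
    to the sup norm, be used for the Euclidean one. *)
Lemma enorm_le_normr x : enorm x <= n%:R * `|x|.
Proof.
rewrite {1}(row_sum_delta x) (le_trans (enorm_sum _ _ _))//.
have -> : n%:R * `|x| = \sum_(j < n) `|x|.
  by rewrite sumr_const card_ord mulr_natl.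
rewrite ler_sum// => j _.
rewrite enormZ -[leRHS]mulr1 ler_pM ?enorm_ge0//.
  rewrite -[leRHS]/(mx_norm x) mx_normrE.
  exact: (le_bigmax _ (fun ij : 'I_1 * 'I_n => `|x ij.1 ij.2|) (ord0, j)).
rewrite /enorm /dot (bigD1 j)//= big1 ?addr0 => [|k kj].
  by rewrite !mxE !eqxx mulr1 sqrtr1.
by rewrite !mxE (negPf kj) andbF mulr0.
Qed.

End Euclidean.

(** * Sublinear functions and Hahn-Banach in finite dimension *)

Definition sublinear (R : realType) (d : nat) (h : 'rV[R]_d -> R) : Prop :=
  (forall p q, h (p + q) <= h p + h q) /\
  (forall t p, 0 <= t -> h (t *: p) = t * h p).

Section SupportFunctions.
Variables (R : realType) (d : nat).
Implicit Types (h g : 'rV[R]_d -> R) (u p q x : 'rV[R]_d).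

Lemma sublinear0 h : sublinear h -> h 0 = 0.
Proof. by move=> [_ hZ]; rewrite -(scale0r 0) hZ// mul0r. Qed.

Lemma sublinear_sum h (I : Type) (r : seq I) (F : I -> 'rV[R]_d) :
  sublinear h -> h (\sum_(i <- r) F i) <= \sum_(i <- r) h (F i).
Proof.
move=> hS; elim/big_ind2 : _ => // [|x a y b xa yb]; first by rewrite sublinear0.
by rewrite (le_trans (hS.1 _ _)) ?lerD.
Qed.

(* The witness is [p |-> inf_(t >= 0) (h (p + t u) - t h u)]; the last clause
   makes it linear along [u]. *)
Lemma sublinear_linearize h u : sublinear h ->
  exists f, [/\ sublinear f, forall p, f p <= h p & f (- u) <= - h u].
Proof.
move=> hS; have [hD hZ] := hS.
pose V p := [set h (p + t *: u) - t * h u | t in [set t : R | 0 <= t]].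
(* Subadditivity for [t *: u = (p + t *: u) + (- p)]; this keeps the infimum finite. *)
have lbV p : lbound (V p) (- h (- p)).
  move=> _ [t t0 <-]; rewrite -(hZ t)//.
  by have := hD (p + t *: u) (- p); rewrite addrAC subrr add0r; lra.
have V0 p : V p !=set0 by exists (h (p + 0 *: u) - 0 * h u); exists 0 => /=.
have infV p t : 0 <= t -> inf (V p) <= h (p + t *: u) - t * h u.
  by move=> t0; apply: ge_inf; [exists (- h (- p)); exact: lbV|exists t].
have infVP p c : (forall t, 0 <= t -> c <= h (p + t *: u) - t * h u) ->
    c <= inf (V p).
  by move=> H; apply: lb_le_inf => // _ [t t0 <-]; exact: H.
exists (fun p => inf (V p)); split.
- split=> [p q|t p].
    rewrite -lerBlDr; apply: (infVP p) => t t0.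
    rewrite lerBlDr -lerBlDl; apply: (infVP q) => s s0; rewrite lerBlDl.
    have := infV (p + q) (s + t) (addr_ge0 s0 t0).
    have := hD (p + t *: u) (q + s *: u).
    rewrite (_ : p + t *: u + _ = p + q + (s + t) *: u); first by lra.
    by rewrite addrACA -scalerDl (addrC t).
  rewrite le_eqVlt => /predU1P[<-|t0].
    rewrite scale0r mul0r; apply/eqP; rewrite eq_le; apply/andP; split.
      by have := infV 0 0 (lexx 0); rewrite scale0r addr0 mul0r sublinear0 ?subr0.
    by apply: infVP => s s0; rewrite add0r hZ// subrr.
  apply/eqP; rewrite eq_le; apply/andP; split.
    rewrite -ler_pdivrMl//; apply: infVP => s s0; rewrite ler_pdivrMl//.
    have := infV (t *: p) (t * s) (mulr_ge0 (ltW t0) s0).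
    by rewrite -scalerA -scalerDr hZ ?(ltW t0)// -mulrA -mulrBr.
  apply: infVP => s s0.
  have ts0 : 0 <= t^-1 * s by rewrite mulr_ge0// invr_ge0 ltW.
  have := infV p _ ts0.
  rewrite -(ler_pM2l t0) mulrBr -(hZ t (_ + _)) ?(ltW t0)// scalerDr scalerA !mulrA.
  by rewrite divff ?gt_eqF// mul1r.
- by move=> p; have := infV p 0 (lexx 0); rewrite scale0r addr0 mul0r subr0.
- by have := infV (- u) 1 ler01; rewrite scale1r addNr sublinear0// mul1r sub0r.
Qed.

(** Apply [sublinear_linearize] along each vector in turn. Later functions are pointwise smaller, so
    the final [k] satisfies [k (- u) <= f (- u) <= - h u <= - k u]. *)
Lemma sublinear_linearize_seq h (us : seq 'rV[R]_d) : sublinear h ->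
  exists f, [/\ sublinear f, forall p, f p <= h p &
    forall u, u \in us -> f (- u) <= - f u].
Proof.
elim: us h => [|u us IH] h hS; first by exists h.
have [f [fS fh fu]] := sublinear_linearize u hS.
have [k [kS kf kus]] := IH f fS.
exists k; split=> // [p|v]; first exact: le_trans (kf p) (fh p).
rewrite inE => /predU1P[->|/kus//].
rewrite (le_trans (kf _))// (le_trans fu)// lerN2.
exact: le_trans (kf u) (fh u).
Qed.

(** For sublinear [g], its subdifferential at the origin, with linear forms written as vectors. *)
Definition subdiff g : set 'rV[R]_d := [set q | forall p, dot p q <= g p].

(** Finite-dimensional Hahn-Banach. Linearising along [p0] first freezes the value [g p0];
    linearising along the standard basis then leaves a linear form, whose values on the basis are
    the coordinates of [q]. *)
Lemma subdiff_attained g p0 : sublinear g ->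
  exists2 q, subdiff g q & g p0 <= dot p0 q.
Proof.
move=> gS; have [h [hS hg hp0]] := sublinear_linearize p0 gS.
pose e j : 'rV[R]_d := delta_mx ord0 j.
have [f [fS fh fe]] := sublinear_linearize_seq [seq e j | j <- enum 'I_d] hS.
have {}fe j : f (- e j) <= - f (e j).
  by apply/fe/map_f; rewrite mem_enum.
pose q : 'rV[R]_d := \row_j f (e j).
have dotq p : f (- p) <= - dot p q.
  rewrite {1}(row_sum_delta p) -sumrN /dot -sumrN.
  rewrite (le_trans (sublinear_sum _ _ fS))// ler_sum// => j _.
  (* The sign of the coordinate decides whether homogeneity is applied to [e j] or to [- e j]; the
     latter case uses [fe]. *)
  rewrite mxE -scaleNr; have [pj|/ltW pj] := leP (p ord0 j) 0.
    by rewrite fS.2 ?oppr_ge0// mulNr.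
  by rewrite scaleNr -scalerN fS.2// -mulrN ler_wpM2l.
exists q => [p|].
  have := fS.1 p (- p); rewrite subrr sublinear0// => ?.
  by have := dotq p; have := fh p; have := hg p; lra.
(* This gives [f p0 <= dot p0 q], while [f (- p0) <= h (- p0) <= - g p0] forces [g p0 <= f p0]. *)
have := dotq (- p0); rewrite opprK dotNl opprK.
have := fS.1 p0 (- p0); rewrite subrr sublinear0// => ?.
by have := fh (- p0); lra.
Qed.

End SupportFunctions.

(** * Closed convex sets with a prescribed support function *)

Section SupportedSets.
Variables (R : realType) (d : nat) (g : 'rV[R]_d -> R).
Implicit Types (Gamma : set 'rV[R]_d) (p q x : 'rV[R]_d).

Lemma bounded_set_enorm Gamma : bounded_set Gamma ->
  exists2 K, 0 <= K & forall q, Gamma q -> enorm q <= K.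
Proof.
(* Every number strictly above [M] is a bound, hence [M + 1]; the maximum with 0 keeps the constant
   nonnegative even for an empty set. *)
move=> [M [_ HM]]; exists (d%:R * Num.max (M + 1) 0) => [|q Gq].
  by rewrite mulr_ge0// le_max lexx orbT.
rewrite (le_trans (enorm_le_normr q))// ler_wpM2l// le_max.
by rewrite (HM (M + 1)) ?ltrDl ?ltr01.
Qed.

Lemma convex_set_combine Gamma (t : R) p q : convex_set Gamma ->
  0 <= t -> t <= 1 -> Gamma p -> Gamma q -> Gamma (t *: p + (1 - t) *: q).
Proof.
move=> Gc t0 t1 Gp Gq; apply/set_mem.
by apply: (Gc p q (Itv01 t0 t1)); exact/mem_set.
Qed.

Lemma supported_by_le Gamma p q : supported_by g Gamma -> Gamma q ->
  dot p q <= g p.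
Proof.
move=> [_ Gb _ _ ->] Gq; apply: ub_le_sup; last by exists q.
have [K K0 HK] := bounded_set_enorm Gb.
exists (enorm p * K) => _ [z Gz <-].
by rewrite (le_trans (dot_le _ _))// ler_wpM2l ?enorm_ge0// HK.
Qed.

Lemma supported_by_approx Gamma p (e : R) : supported_by g Gamma -> 0 < e ->
  exists2 q, Gamma q & g p - e < dot p q.
Proof.
move=> GS e0; have [[q0 Gq0] _ _ _ gE] := GS.
have hs : has_sup [set dot p q | q in Gamma].
  split; first by exists (dot p q0), q0.
  by exists (g p) => _ [q Gq <-]; exact: supported_by_le GS Gq.
by have [_ [q Gq <-]] := sup_adherent e0 hs; rewrite -gE; exists q.
Qed.

(* Separation without attained distances: if [pi] is a point of [Gamma] whose
   squared distance to [x] is within [t ^+ 2] of the infimum, then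
   [v = x - pi] separates [x] from [Gamma] up to an error [O(t)]. *)
Lemma supported_by_subdiff Gamma : supported_by g Gamma -> Gamma = subdiff g.
Proof.
move=> GS; apply/seteqP; split=> [q Gq p|x gx]; first exact: supported_by_le GS Gq.
have [[q0 Gq0] Gb Gc Gcl gE] := GS; have [K K0 HK] := bounded_set_enorm Gb.
apply: contrapT => nGx.
have : nbhs x (~` Gamma) by apply: open_nbhs_nbhs; split => //; exact: closed_openC.
move=> /nbhs_ballP[e /= e0 xe].
have {}xe z : Gamma z -> e ^+ 2 <= enorm (x - z) ^+ 2.
  move=> Gz; rewrite ler_pXn2r ?nnegrE ?enorm_ge0 ?(ltW e0)//.
  rewrite leNgt; apply/negP => xze; apply: (xe z) => //.
  rewrite -ball_normE /=; apply: le_lt_trans xze; exact: normr_le_enorm.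
pose m := inf [set enorm (x - z) ^+ 2 | z in Gamma].
have hi : has_inf [set enorm (x - z) ^+ 2 | z in Gamma].
  split; first by exists (enorm (x - q0) ^+ 2), q0.
  by exists 0 => _ [z _ <-]; rewrite sqr_ge0.
have mz z : Gamma z -> m <= enorm (x - z) ^+ 2.
  by move=> Gz; apply: ge_inf; [exact: hi.2|exists z].
pose B := 1 + (K + K) ^+ 2.
have B1 : 1 <= B by rewrite /B lerDl sqr_ge0.
have B0 : 0 < B by rewrite (lt_le_trans ltr01).
(* [t <= 1] makes [t] a convex weight, and [t * B <= e ^+ 2] keeps the separation error [t * B / 2]
   below [enorm v ^+ 2]. *)
pose t := Num.min 1 (e ^+ 2 / B).
have t0 : 0 < t by rewrite /t lt_min ltr01 divr_gt0// exprn_gt0.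
have t1 : t <= 1 by rewrite /t ge_min lexx.
have tB : t * B <= e ^+ 2 by rewrite -ler_pdivlMr// /t ge_min lexx orbT.
have [_ [pi Gpi <-]] := inf_adherent (exprn_gt0 2 t0) hi; rewrite -/m => pim.
pose v := x - pi.
have vz z : Gamma z -> dot v z <= dot v pi + t * B / 2.
  move=> Gz.
  (* Compare the near-minimal [pi] with the point at parameter [t] on the segment from [pi] to [z],
     expand the square and cancel [t]. *)
  have := mz _ (convex_set_combine Gc (ltW t0) t1 Gz Gpi).
  have -> : x - (t *: z + (1 - t) *: pi) = v - t *: (z - pi).
    by apply/rowP => j; rewrite !mxE; ring.
  rewrite sqr_enormB dotZr dotBr enormZ exprMn real_normK ?num_real//.
  have : enorm (z - pi) ^+ 2 <= (K + K) ^+ 2.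
    rewrite ler_pXn2r ?nnegrE ?enorm_ge0 ?addr_ge0//.
    by rewrite (le_trans (enormB _ _))// lerD// HK.
  rewrite -/v in pim.
  move=> zK H.
  have : 0 <= t * (dot v pi + t * B / 2 - dot v z).
    have := ler_wpM2l (sqr_ge0 t) zK; rewrite /B; move: H pim; lra.
  by rewrite pmulr_rge0// subr_ge0.
have gv : g v <= dot v pi + t * B / 2.
  by rewrite gE; apply: ge_sup => [|_ [z Gz <-]]; [exists (dot v q0), q0|exact: vz].
(* Testing [x] in the direction [v] gives [enorm v ^+ 2 <= t * B / 2 <= e ^+ 2 / 2], against
   [e ^+ 2 <= enorm v ^+ 2]. *)
have := gx v; rewrite -[X in dot v X](subrK pi) -/v dotDr -sqr_enorm.
by have := xe _ Gpi; rewrite -/v; have := exprn_gt0 2 e0; lra.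
Qed.

(** An intersection of closed half-spaces is closed and convex; plus and minus basis vectors bound
    the coordinates; [subdiff_attained] provides a point and the value of the support function. *)
Lemma subdiff_supported_by : sublinear g -> supported_by g (subdiff g).
Proof.
move=> gS; split.
- by have [q qg _] := subdiff_attained 0 gS; exists q.
- pose e j : 'rV[R]_d := delta_mx ord0 j.
  have dote j q : dot (e j) q = q ord0 j.
    rewrite /dot (bigD1 j)//= big1 ?addr0 ?mxE ?eqxx ?mul1r// => k kj.
    by rewrite mxE (negPf kj) andbF mul0r.
  pose K := \sum_j (`|g (e j)| + `|g (- e j)|).
  exists K; split; first exact: num_real.
  move=> M KM q gq /=; apply: le_trans (ltW KM).
  rewrite -[leLHS]/(mx_norm q) mx_normrE; apply/bigmax_leP; split=> [|[i j] _] /=.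
    by apply: sumr_ge0 => j _; rewrite addr_ge0.
  rewrite (ord1 i) /K (bigD1 j)//= ler_wpDr//.
    by apply: sumr_ge0 => k _; rewrite addr_ge0.
  have := gq (e j); have := gq (- e j); rewrite dotNl dote => h1 h2.
  rewrite ler_norml; have := ler_norm (g (e j)); have := ler_norm (g (- e j)).
  by have := normr_ge0 (g (e j)); have := normr_ge0 (g (- e j)); lra.
- move=> x y t /set_mem gx /set_mem gy; apply/mem_set => p.
  rewrite /= /conv/= dotDr !dotZr.
  have t0 : 0 <= t%:num by [].
  have t1 : 0 <= 1 - t%:num by rewrite subr_ge0.
  have := ler_wpM2l t0 (gx p); have := ler_wpM2l t1 (gy p).
  by rewrite /unstable.onem; lra.
- move=> q clq p; apply/ler_addgt0Pr => e e0.
  (* The summand 1 keeps the denominator positive when [p] or [d] is zero. *)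
  have c0 : 0 < enorm p * d%:R + 1.
    by rewrite ltr_wpDl ?ltr01// mulr_ge0// enorm_ge0.
  have [z [gz]] := clq _ (nbhsx_ballx q (e / (enorm p * d%:R + 1)) (divr_gt0 e0 c0)).
  rewrite -ball_normE /= => qz.
  rewrite -(subrK z q) dotDr addrC lerD ?gz//.
  rewrite (le_trans (dot_le _ _))//.
  rewrite (le_trans (ler_wpM2l (enorm_ge0 p) (enorm_le_normr _)))// mulrA.
  rewrite (le_trans (ler_wpM2l _ (ltW qz))) ?mulr_ge0 ?enorm_ge0//.
  by rewrite mulrA ler_pdivrMr// mulrC ler_pM2l// lerDl.
- move=> p; apply/eqP; rewrite eq_le; apply/andP; split.
    have [q gq gp] := subdiff_attained p gS.
    apply: le_trans gp _; apply: ub_le_sup; last by exists q.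
    by exists (g p) => _ [z gz <-]; exact: gz.
  have [q gq _] := subdiff_attained p gS.
  by apply: ge_sup => [|_ [z gz <-]]; [exists (dot p q), q|exact: gz].
Qed.

End SupportedSets.

(** * Locally Lipschitz test functions of at most quadratic growth *)

Definition enorm_lip (R : realType) (n m : nat) (h : 'rV[R]_n -> 'rV[R]_m) : Prop :=
  exists2 K, 0 <= K & forall x y, enorm (h x - h y) <= K * enorm (x - y).

(* Exponent 1 in [C_l_Lip] suffices for squared distances, and this class is
   stable under [f |-> (x |-> expect (f (x + Y)))] without higher moments. *)
Definition quad_lip (R : realType) (n : nat) (f : 'rV[R]_n -> R) : Prop :=
  exists2 C, 0 <= C & forall x y,
    `|f x - f y| <= C * (1 + enorm x + enorm y) * enorm (x - y).

Section LipschitzClasses.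
Variables (R : realType) (n m : nat).
Implicit Types (f : 'rV[R]_n -> R).

Lemma quad_lip_C_l_Lip f : quad_lip f -> C_l_Lip f.
Proof.
move=> [C C0 fC]; exists (C + 1), 1%N; split; first by rewrite ltr_wpDl.
move=> x y; rewrite (le_trans (fC x y))// !expr1 ler_wpM2r ?enorm_ge0//.
by rewrite ler_wpM2r ?lerDl// !addr_ge0 ?enorm_ge0.
Qed.

Lemma linear_enorm_lip (h : 'rV[R]_n -> 'rV[R]_m) : linear h -> enorm_lip h.
Proof.
move=> hP; pose hL := GRing.isLinear.Build R _ _ _ h hP.
pose H : {linear 'rV[R]_n -> 'rV[R]_m} := HB.pack h hL.
exists (\sum_j enorm (H (delta_mx ord0 j))) => [|x y].
  by apply: sumr_ge0 => j _; exact: enorm_ge0.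
rewrite -[h x - h y]/(H x - H y) -linearB; set z := x - y.
rewrite [in leLHS](row_sum_delta z) linear_sum (le_trans (enorm_sum _ _ _))//.
rewrite mulr_suml ler_sum// => j _.
by rewrite linearZ enormZ mulrC ler_wpM2l ?enorm_ge0// coord_le_enorm.
Qed.

(** Since [h] grows at most linearly, the weight [1 + enorm (h x) + enorm (h y)] is bounded by a
    multiple of [1 + enorm x + enorm y]. *)
Lemma quad_lip_comp f (h : 'rV[R]_m -> 'rV[R]_n) :
  quad_lip f -> enorm_lip h -> quad_lip (f \o h).
Proof.
move=> [C C0 fC] [K K0 hK].
have h0 x : enorm (h x) <= enorm (h 0) + K * enorm x.
  rewrite -[in leLHS](subrK (h 0) (h x)) (le_trans (enormD _ _))// addrC lerD2l.
  by rewrite (le_trans (hK _ _))// subr0.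
exists (C * (1 + 2 * enorm (h 0) + K) * K) => [|x y].
  by rewrite !mulr_ge0// !addr_ge0// mulr_ge0 ?enorm_ge0.
rewrite (le_trans (fC _ _))//.
rewrite -2!mulrA -[leRHS]mulrA -[leRHS]mulrA ler_wpM2l//.
have e0 := enorm_ge0 (h 0).
have x0 := enorm_ge0 x; have y0 := enorm_ge0 y.
apply: (@le_trans _ _ ((1 + 2 * enorm (h 0) + K) * (1 + enorm x + enorm y)
    * (K * enorm (x - y)))); last by rewrite le_eqVlt; apply/orP; left; apply/eqP; ring.
apply: ler_pM => //; rewrite ?enorm_ge0 ?addr_ge0 ?enorm_ge0//.
have := h0 x; have := h0 y; have := mulr_ge0 e0 x0; have := mulr_ge0 e0 y0.
nra.
Qed.

Lemma quad_lipN f : quad_lip f -> quad_lip (fun x => - f x).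
Proof.
by move=> [C C0 fC]; exists C => // x y; rewrite -opprD normrN.
Qed.

Lemma enorm_lip_quad_lip f (K : R) :
  (forall x y, `|f x - f y| <= K * enorm (x - y)) -> quad_lip f.
Proof.
move=> fK; exists `|K| => // x y; rewrite (le_trans (fK x y))//.
rewrite ler_wpM2r ?enorm_ge0// (le_trans (ler_norm K))// ler_peMr//.
by rewrite -addrA lerDl addr_ge0 ?enorm_ge0.
Qed.

Lemma quad_lip_enorm : quad_lip (@enorm R n).
Proof.
by apply: (@enorm_lip_quad_lip _ 1) => x y; rewrite mul1r dist_enorm.
Qed.

Lemma quad_lip_sqr_enorm : quad_lip (fun x : 'rV[R]_n => enorm x ^+ 2).
Proof.
exists 1 => // x y; rewrite subr_sqr normrM mul1r mulrC ler_pM ?dist_enorm//.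
by rewrite ger0_norm ?addr_ge0 ?enorm_ge0// -addrA lerDr.
Qed.

Lemma quad_lip_dot p : quad_lip (fun x : 'rV[R]_n => dot x p).
Proof.
apply: (@enorm_lip_quad_lip _ (enorm p)) => x y.
by rewrite -dotBl mulrC normr_dot_le.
Qed.

Lemma enorm_lip_affine (a : R) (b : 'rV[R]_n) :
  enorm_lip (fun x => a *: x + b).
Proof.
by exists `|a| => // x y; rewrite opprD addrACA subrr addr0 -scalerBr enormZ.
Qed.

End LipschitzClasses.

Lemma quad_lip_translate (R : realType) (n : nat) (f : 'rV[R]_n -> R) (b : 'rV[R]_n) :
  quad_lip f -> quad_lip (fun x => f (x + b)).
Proof.
move=> fq; have := quad_lip_comp fq (enorm_lip_affine 1 b).
by congr quad_lip; apply/funext => x /=; rewrite scale1r.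
Qed.

(** * Calculus of a sublinear expectation and independence *)

Section Expectation.
Variables (R : realType) (S : sublinear_space R).
Implicit Types (X Y : carrier S -> R).

Lemma rv_opp X : rv X -> rv (fun w => - X w).
Proof.
move=> HX; have := rv_scale (-1) HX; congr rv.
by apply/funext => w; rewrite mulN1r.
Qed.

Lemma rv_sub X Y : rv X -> rv Y -> rv (fun w => X w - Y w).
Proof. by move=> HX HY; apply: rv_add => //; exact: rv_opp. Qed.

Lemma expect_subr X Y : rv X -> rv Y ->
  expect X - expect Y <= expect (fun w => X w - Y w).
Proof.
move=> HX HY; rewrite lerBlDr; have := expect_subadd (rv_sub HX HY) HY.
by congr (expect _ <= _); apply/funext => w; rewrite subrK.
Qed.

Lemma expect_addc X (c : R) : rv X -> expect (fun w => X w + c) <= expect X + c.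
Proof.
by move=> HX; have := expect_subadd HX (rv_cst S c); rewrite expect_cst.
Qed.

Lemma expect_dist X Y : rv X -> rv Y ->
  `|expect X - expect Y| <= expect (fun w => `|X w - Y w|).
Proof.
move=> HX HY; have HXY := rv_abs (rv_sub HX HY).
rewrite ler_norml lerNl opprB; apply/andP; split.
  apply: le_trans (expect_subr HY HX) _; apply: expect_mono => //.
    exact: rv_sub.
  by move=> w; rewrite distrC ler_norm.
apply: le_trans (expect_subr HX HY) _; apply: expect_mono => //.
  exact: rv_sub.
by move=> w; exact: ler_norm.
Qed.

Lemma rv_quad_lip (n : nat) (X : carrier S -> 'rV[R]_n) (f : 'rV[R]_n -> R) :
  random_vector X -> quad_lip f -> rv (fun w => f (X w)).
Proof.
move=> HX /quad_lip_C_l_Lip fl.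
have := @rv_comp R S n (fun j w => X w ord0 j) f HX fl.
by congr rv; apply/funext => w; congr f; apply/rowP => j; rewrite mxE.
Qed.

(** This makes the inner expectation of the independence formula an admissible function of the
    partial sum. The weight has degree one, so averaging it over [Y] costs only the first moment
    [E]. *)
Lemma quad_lip_expect (n : nat) (Y : carrier S -> 'rV[R]_n) (f : 'rV[R]_n -> R) :
  random_vector Y -> quad_lip f ->
  quad_lip (fun x => expect (fun w => f (x + Y w))).
Proof.
move=> HY fq; have [C C0 fC] := fq.
have rvf x : rv (fun w => f (x + Y w)).
  have := rv_quad_lip HY (quad_lip_translate x fq); congr rv.
  by apply/funext => w; rewrite addrC.
have rvn := rv_quad_lip HY (@quad_lip_enorm R n).
set E := expect (fun w => enorm (Y w)).
have E0 : 0 <= E.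
  rewrite -(expect_cst S 0); apply: expect_mono => // [|w]; first exact: rv_cst.
  exact: enorm_ge0.
exists (C * (1 + 2 * E)) => [|x y]; first by rewrite mulr_ge0// addr_ge0 ?mulr_ge0.
rewrite (le_trans (expect_dist (rvf x) (rvf y)))//.
set a := enorm x; set b := enorm y; set e := enorm (x - y).
have [a0 b0 e0] : [/\ 0 <= a, 0 <= b & 0 <= e] by split; exact: enorm_ge0.
pose c := C * e * 2; have c0 : 0 <= c by rewrite /c !mulr_ge0.
apply: (@le_trans _ _ (expect (fun w => c * enorm (Y w) + C * e * (1 + a + b)))).
  apply: expect_mono => [||w].
  - by apply: rv_add; [exact: rv_scale|exact: rv_cst].
  - by apply: rv_abs; exact: rv_sub.
  - rewrite (le_trans (fC _ _))// opprD addrACA subrr addr0 -/e.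
    have := enormD x (Y w); have := enormD y (Y w); rewrite -/a -/b.
    set u := enorm (x + _); set v := enorm (y + _); set z := enorm (Y w) => h1 h2.
    have : C * e * (1 + u + v) <= C * e * (1 + (a + z) + (b + z)).
      by rewrite ler_wpM2l ?mulr_ge0//; lra.
    by rewrite /c; lra.
rewrite (le_trans (expect_addc _ (rv_scale _ rvn)))//.
rewrite expect_pos_hom// -/E /c.
have := mulr_ge0 (mulr_ge0 C0 e0) (mulr_ge0 E0 (addr_ge0 a0 b0)); lra.
Qed.

Lemma random_vector_sum (n : nat) (Y : nat -> carrier S -> 'rV[R]_n) k :
  (forall i, random_vector (Y i)) ->
  random_vector (fun w => \sum_(i < k) Y i w).
Proof.
move=> HY j; elim: k => [|k IH].
  have := rv_cst S 0; congr rv; apply/funext => w.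
  by rewrite big_ord0 mxE.
have := rv_add IH (HY k j); congr rv; apply/funext => w.
by rewrite big_ord_recr mxE.
Qed.

(** Independence speaks of the flattened history, but the next partial sum is a linear function [h]
    of the history and the new vector, so [f \o h] is an admissible test function. *)
Lemma expect_sum_indep (n : nat) (Y : nat -> carrier S -> 'rV[R]_n) k
    (f : 'rV[R]_n -> R) :
  independent_from (Y k) (history Y k) -> quad_lip f ->
  expect (fun w => f (\sum_(i < k.+1) Y i w)) =
  expect (fun w => expect (fun w' => f (\sum_(i < k) Y i w + Y k w'))).
Proof.
move=> ind fq.
pose h (z : 'rV[R]_(k * n + n)) : 'rV[R]_n :=
  \sum_(i < k) row i (vec_mx (lsubmx z)) + rsubmx z.
have hP : linear h.
  move=> a x y; rewrite /h !linearP /= scalerDr addrACA; congr (_ + _).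
  rewrite scaler_sumr -big_split; apply: eq_bigr => i _.
  by rewrite !linearP.
have hE w w' : h (row_mx (history Y k w) (Y k w')) = \sum_(i < k) Y i w + Y k w'.
  rewrite /h row_mxKl row_mxKr mxvecK; congr (_ + _).
  by apply: eq_bigr => i _; apply/rowP => j; rewrite !mxE.
have := ind _ (quad_lip_C_l_Lip (quad_lip_comp fq (linear_enorm_lip hP))).
have -> : (fun w => (f \o h) (row_mx (history Y k w) (Y k w))) =
    (fun w => f (\sum_(i < k.+1) Y i w)).
  by apply/funext => w; rewrite /= hE big_ord_recr.
move=> ->; congr expect; apply/funext => w; congr expect; apply/funext => w'.
by rewrite /= hE.
Qed.

End Expectation.

(** * Elementary real estimates *)

(** Increments of order [e * k + 1] add up to order [e * n ^+ 2 + n], and the linear term is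
    eventually absorbed. *)
Lemma quadratic_growth (R : realType) (a : nat -> R) (C : R) : 0 <= C ->
  (forall e, 0 < e -> exists N, forall k, (N <= k)%N ->
     a k.+1 <= a k + C * (e * k%:R + 1)) ->
  forall e, 0 < e -> exists N, forall n, (N <= n)%N -> a n <= e * n%:R ^+ 2.
Proof.
move=> C0 H e e0.
have C1 : 0 < C + 1 by rewrite ltr_wpDl.
(* The quarter leaves room for the start value and the linear term; [C + 1] avoids a zero
   denominator. *)
have [N HN] := H (e / (4 * (C + 1))) (divr_gt0 e0 (mulr_gt0 (ltr0n _ 4) C1)).
set e' := e / _ in HN.
have e'0 : 0 < e' by rewrite divr_gt0// mulr_gt0.
have Ce' : C * e' <= e / 4.
  rewrite /e' invfM !mulrA ler_pdivrMr//.
  have : 0 <= e / 4 by rewrite divr_ge0 ?ltW.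
  by lra.
(* Each of the [j] increments is majorised by its value at the endpoint [N + j]. *)
have aN j : a (N + j)%N <= `|a N| + C * j%:R * (e' * (N + j)%:R + 1).
  elim: j => [|j IH]; first by rewrite addn0 mulr0 mul0r addr0 ler_norm.
  have hu : e' * (N + j)%:R <= e' * (N + j.+1)%:R.
    by rewrite ler_pM2l// ler_nat leq_add2l.
  have := ler_wpM2l (mulr_ge0 C0 (ler0n R j.+1)) hu.
  have := HN _ (leq_addr j N); rewrite addnS -(natr1 j).
  by move: IH; lra.
(* From [N1] on, [C] and the absolute value of [a N] are each at most [e * n / 4]. *)
pose N1 := (N + Num.bound (4 * C / e) + Num.bound (4 * `|a N| / e)).+1.
exists N1 => n nN1.
have [j nE] : exists j, n = (N + j)%N.
  by exists (n - N)%N; rewrite subnKC// (leq_trans _ nN1)// leqW// -addnA leq_addr.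
have jn : j%:R <= n%:R :> R by rewrite ler_nat nE leq_addl.
have n1 : 1 <= n%:R :> R.
  by rewrite ler1n (leq_trans _ nN1).
have nC : 4 * C / e <= n%:R.
  rewrite (le_trans (ltW (archi_boundP _)))//; first by rewrite divr_ge0 ?mulr_ge0 ?(ltW e0).
  by rewrite ler_nat (leq_trans _ nN1)// leqW// addnAC leq_addl.
have na : 4 * `|a N| / e <= n%:R.
  rewrite (le_trans (ltW (archi_boundP _)))//; first by rewrite divr_ge0 ?mulr_ge0 ?(ltW e0).
  by rewrite ler_nat (leq_trans _ nN1)// leqW// leq_addl.
move: nC na; rewrite !ler_pdivrMr// => nC na.
have := aN j; rewrite -nE => /le_trans; apply.
have n0 : 0 <= n%:R :> R by [].
have h1 : C * j%:R * (e' * n%:R + 1) <= C * n%:R * (e' * n%:R + 1).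
  by rewrite ler_wpM2r ?ler_wpM2l// addr_ge0// mulr_ge0// ltW.
have h2 := ler_wpM2r (sqr_ge0 n%:R) Ce'.
have h3 := ler_wpM2l n0 nC.
have h4 : n%:R * e <= e * n%:R ^+ 2.
  by rewrite mulrC ler_pM2l// expr2 ler_peMr.
by lra.
Qed.

(** This is [u <= e + u ^+ 2 / e], from [0 <= (u - e) ^+ 2]. It converts estimates of squared
    distances into bounds for Lipschitz functions of the mean. *)
Lemma enorm_scale_sub_le (R : realType) (d n : nat) (x q : 'rV[R]_d) (e : R) :
  (0 < n)%N -> 0 < e ->
  enorm (n%:R^-1 *: x - q) <= e + (e * n%:R ^+ 2)^-1 * enorm (x - n%:R *: q) ^+ 2.
Proof.
move=> n0 e0; have n0' : 0 < n%:R :> R by rewrite ltr0n.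
set u := enorm (n%:R^-1 *: x - q).
have -> : enorm (x - n%:R *: q) = n%:R * u.
  rewrite /u -{2}[n%:R]gtr0_norm// -enormZ scalerBr scalerA divff ?gt_eqF//.
  by rewrite scale1r.
rewrite exprMn invfM mulrA mulfVK ?gt_eqF ?exprn_gt0//.
rewrite -(ler_pM2l e0) mulrDr mulrA divff ?gt_eqF// mul1r.
by have := sqr_ge0 (u - e); have := enorm_ge0 (n%:R^-1 *: x - q); rewrite -/u; nra.
Qed.

(** * Squared distance to the dilates of a bounded set *)

Section SquaredDistance.
Variables (R : realType) (d : nat) (Gamma : set 'rV[R]_d) (K : R).
Hypothesis Gamma0 : Gamma !=set0.
Hypothesis K0 : 0 <= K.
Hypothesis GammaK : forall q, Gamma q -> enorm q <= K.

Definition sqdist k (x : 'rV[R]_d) : R :=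
  inf [set enorm (x - k%:R *: q) ^+ 2 | q in Gamma].

Lemma sqdist_le k x q : Gamma q -> sqdist k x <= enorm (x - k%:R *: q) ^+ 2.
Proof.
move=> Gq; apply: ge_inf; last by exists q.
by exists 0 => _ [z _ <-]; rewrite sqr_ge0.
Qed.

Lemma sqdist_approx k x (e : R) : 0 < e ->
  exists2 q, Gamma q & enorm (x - k%:R *: q) ^+ 2 < sqdist k x + e.
Proof.
move=> e0; have hi : has_inf [set enorm (x - k%:R *: q) ^+ 2 | q in Gamma].
  have [q Gq] := Gamma0; split; first by exists (enorm (x - k%:R *: q) ^+ 2), q.
  by exists 0 => _ [z _ <-]; rewrite sqr_ge0.
by have [_ [q Gq <-] xq] := inf_adherent e0 hi; exists q.
Qed.

Lemma enorm_sub_dilation k x q : Gamma q ->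
  enorm (x - k%:R *: q) <= enorm x + k%:R * K.
Proof.
move=> Gq; rewrite (le_trans (enormB _ _))// lerD2l enormZ ger0_norm//.
by rewrite ler_wpM2l// GammaK.
Qed.

(** Insert a near-minimiser [q] for [y] and factor the difference of squares: the norms differ by at
    most [enorm (x - y)], and their sum is at most [enorm x + enorm y] plus twice [k%:R * K]. *)
Lemma quad_lip_sqdist k : quad_lip (sqdist k).
Proof.
have kK : 0 <= k%:R * K by rewrite mulr_ge0.
pose c := 1 + 2 * (k%:R * K).
have half x y : sqdist k x - sqdist k y <=
    c * (1 + enorm x + enorm y) * enorm (x - y).
  apply/ler_addgt0Pr => e e0; have [q Gq yq] := sqdist_approx k y e0.
  have xq := sqdist_le k x Gq.
  have ex := enorm_sub_dilation k x Gq; have ey := enorm_sub_dilation k y Gq.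
  have : enorm (x - k%:R *: q) <= enorm (x - y) + enorm (y - k%:R *: q).
    by rewrite (le_trans _ (enormD _ _))// addrA subrK.
  move: ex ey xq yq (enorm_ge0 (x - k%:R *: q)) (enorm_ge0 (y - k%:R *: q)).
  set u := enorm (x - _ *: q); set v := enorm (y - _ *: q).
  set s := enorm (x - y); rewrite /c.
  move: (enorm_ge0 x) (enorm_ge0 y) (enorm_ge0 (x - y)); rewrite -/s.
  move: (enorm x) (enorm y) (k%:R * K) kK => a b r r0 a0 b0 s0 ux vy h1 h2 u0 v0 uv.
  have : u ^+ 2 - v ^+ 2 <= (a + r + (b + r)) * s.
    rewrite subr_sqr mulrC (le_trans (ler_wpM2l (addr_ge0 u0 v0) (_ : _ <= s)))//.
      by rewrite lerBlDr.
    by rewrite ler_wpM2r// lerD.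
  have := mulr_ge0 (mulr_ge0 r0 s0) (addr_ge0 a0 b0); lra.
exists c => [|x y]; first by rewrite addr_ge0// mulr_ge0.
rewrite ler_norml half andbT lerNl opprB enormBC.
by have := half y x; rewrite addrAC.
Qed.

End SquaredDistance.

(** * Uniform moment bounds and the limit function [g] *)

Section LawOfLargeNumbers.
Variables (R : realType) (S : sublinear_space R) (d : nat).
Variable Y : nat -> carrier S -> 'rV[R]_d.
Hypothesis Y_rv : forall i, random_vector (Y i).
Hypothesis Y_indep : forall i, independent_from (Y i.+1) (history Y i.+1).
Variable M : R.
Hypothesis M0 : 0 < M.
Hypothesis Y_bound : forall i, expect (fun w => enorm (Y i w) ^+ 2) <= M.
Variable g : 'rV[R]_d -> R.
Hypothesis g_lim :
  forall p, (fun i => expect (fun w => dot (Y i w) p)) @ \oo --> g p.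

Let gi i p := expect (fun w => dot (Y i w) p).
(** Bounds all first moments, since [u <= u ^+ 2 + 1], and thereby serves as a common Lipschitz
    constant of [g] and all [gi i]. *)
Let B := 1 + M.
Let B0 : 0 < B. Proof. by rewrite addr_gt0. Qed.
Let rvf i f : quad_lip f -> rv (fun w => f (Y i w)).
Proof. exact: rv_quad_lip. Qed.
Let Sum n w := \sum_(i < n) Y i w.
Let Sum_rv n : random_vector (Sum n).
Proof. exact: random_vector_sum. Qed.

Let rv_dot i p : rv (fun w => dot (Y i w) p).
Proof. exact: (rvf i (quad_lip_dot p)). Qed.

Lemma expect_enorm_le i : expect (fun w => enorm (Y i w)) <= B.
Proof.
have H2 : rv (fun w => enorm (Y i w) ^+ 2) by exact: (rvf i (@quad_lip_sqr_enorm R d)).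
apply: (@le_trans _ _ (expect (fun w => enorm (Y i w) ^+ 2 + 1))); last first.
  by rewrite (le_trans (expect_addc _ H2))// addrC lerD2l.
apply: expect_mono => [||w].
- by apply: rv_add => //; exact: rv_cst.
- exact: (rvf i (@quad_lip_enorm R d)).
- by have := sqr_ge0 (enorm (Y i w) - 1); have := enorm_ge0 (Y i w); nra.
Qed.

Lemma expect_enorm_sum_le n : expect (fun w => enorm (Sum n w)) <= n%:R * B.
Proof.
elim: n => [|n IH].
  rewrite mul0r -[leRHS](expect_cst S); apply: expect_mono => [||w].
  - exact: rv_cst.
  - exact: (rv_quad_lip (Sum_rv 0) (@quad_lip_enorm R d)).
  - by rewrite /Sum big_ord0 enorm0.
have rS : rv (fun w => enorm (Sum n w)).
  exact: (rv_quad_lip (Sum_rv n) (@quad_lip_enorm R d)).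
have rY : rv (fun w => enorm (Y n w)) by exact: (rvf n (@quad_lip_enorm R d)).
rewrite -natr1 mulrDl mul1r (le_trans _ (lerD IH (expect_enorm_le n)))//.
apply: le_trans (expect_subadd rS rY); apply: expect_mono => [||w].
- exact: rv_add.
- exact: (rv_quad_lip (Sum_rv n.+1) (@quad_lip_enorm R d)).
- by rewrite /Sum big_ord_recr enormD.
Qed.

Lemma expect_sqr_enormB_le i q :
  expect (fun w => enorm (Y i w - q) ^+ 2) <= 2 * M + 2 * enorm q ^+ 2.
Proof.
have H2 : rv (fun w => enorm (Y i w) ^+ 2) by exact: (rvf i (@quad_lip_sqr_enorm R d)).
have H := @rv_scale _ _ 2 _ H2.
apply: (@le_trans _ _
    (expect (fun w => 2 * enorm (Y i w) ^+ 2 + 2 * enorm q ^+ 2))); last first.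
  rewrite (le_trans (expect_addc _ H))// expect_pos_hom// lerD2r ler_wpM2l//.
apply: expect_mono => [||w].
- by apply: rv_add => //; exact: rv_cst.
- exact: (rvf i (quad_lip_translate (- q) (@quad_lip_sqr_enorm R d))).
- rewrite sqr_enormB; have := sqr_ge0 (enorm (Y i w + q)).
  by rewrite sqr_enormD; lra.
Qed.

Lemma gi_sublinear i : sublinear (gi i).
Proof.
split=> [p q|t p t0].
  rewrite -(_ : expect (fun w => dot (Y i w) p + dot (Y i w) q) = gi i (p + q)).
    exact: expect_subadd.
  by congr expect; apply/funext => w; rewrite dotDr.
rewrite /gi -expect_pos_hom//; congr expect; apply/funext => w.
by rewrite dotZr.
Qed.

Lemma gi_lipschitz i p q : `|gi i p - gi i q| <= B * enorm (p - q).
Proof.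
rewrite (le_trans (expect_dist (rv_dot i p) (rv_dot i q)))// mulrC.
have rn : rv (fun w => enorm (Y i w)) by exact: (rvf i (@quad_lip_enorm R d)).
apply: le_trans (ler_wpM2l (enorm_ge0 _) (expect_enorm_le i)).
rewrite -expect_pos_hom ?enorm_ge0//; apply: expect_mono => [||w].
- exact: rv_scale.
- by apply: rv_abs; exact: rv_sub.
- by rewrite -dotBr mulrC normr_dot_le.
Qed.

Let g_near p (e : R) : 0 < e -> exists N, forall i, (N <= i)%N -> `|g p - gi i p| <= e.
Proof.
move=> e0; have /cvgrPdist_le/(_ e e0)[N _ HN] := @g_lim p.
by exists N => i Ni; exact: HN.
Qed.

Lemma g_sublinear : sublinear g.
Proof.
split=> [p q|t p t0].
- apply/ler_addgt0Pr => e e0; have e3 : 0 < e / 3 by rewrite divr_gt0.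
  have [N1 H1] := g_near p e3; have [N2 H2] := g_near q e3.
  have [N3 H3] := g_near (p + q) e3.
  pose i := maxn N1 (maxn N2 N3).
  have := H1 i (leq_maxl _ _).
  have := H2 i; rewrite /i leq_max leq_maxl orbT -/i => /(_ isT).
  have := H3 i; rewrite /i !leq_max leqnn !orbT -/i => /(_ isT).
  rewrite !ler_norml => /andP[? ?] /andP[? ?] /andP[? ?].
  by have := (gi_sublinear i).1 p q; lra.
- have h1 := @g_lim (t *: p).
  have h2 : (fun i => gi i (t *: p)) @ \oo --> t * g p.
    under eq_fun do rewrite (gi_sublinear _).2//.
    by apply: cvgMr; exact: g_lim.
  exact: (cvg_unique _ h1 h2).
Qed.

Lemma g_lipschitz p q : `|g p - g q| <= B * enorm (p - q).
Proof.
apply/ler_addgt0Pr => e e0; have e2 : 0 < e / 2 by rewrite divr_gt0.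
have [N1 H1] := g_near p e2; have [N2 H2] := g_near q e2.
have := H1 _ (leq_maxl N1 N2); have := H2 _ (leq_maxr N1 N2).
move: (maxn _ _) => i; have := gi_lipschitz i p q.
by rewrite !ler_norml => /andP[? ?] /andP[? ?] /andP[? ?]; lra.
Qed.

(** A common Lipschitz constant upgrades pointwise to uniform convergence on the compact sup-norm
    unit ball; positive homogeneity extends it to all [p] with the factor [enorm p]. *)
Lemma gi_unif_cvg (e : R) : 0 < e ->
  exists N, forall i, (N <= i)%N -> forall p, `|g p - gi i p| <= e * enorm p.
Proof.
move=> e0.
pose K : set 'rV[R]_d := [set p | `|p| <= 1].
have Kc : compact K.
  apply: bounded_closed_compact.
    by exists 1; split; [exact: num_real|move=> x x1 p /le_trans; apply; exact: ltW].
  apply: (preimage_closed _ (@closed_le _ 1)) => y _.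
  exact: norm_continuous.
have := (compact_near_coveringP K).1 Kc nat \oo (fun i p => `|g p - gi i p| <= e) _.
case.
  move=> x _; have e2 : 0 < e / 2 by rewrite divr_gt0.
  have [N HN] := g_near x e2.
  (* Each of the two Lipschitz errors becomes at most [e / 4]; [d.+1] keeps the denominator positive
     in dimension 0. *)
  pose r := e / (4 * B * d.+1%:R).
  have r0 : 0 < r by rewrite divr_gt0// !mulr_gt0.
  exists (ball x r, [set i | (N <= i)%N]) => [|[y i] /= [xy Ni]].
    by split; [exact: nbhsx_ballx|exists N].
  have xyr : B * enorm (x - y) <= e / 4.
    rewrite mulrC -ler_pdivlMr// (le_trans (enorm_le_normr _))//.
    have : `|x - y| <= r by move: xy; rewrite -ball_normE => /ltW.
    move=> /(ler_wpM2l (ler0n R d.+1)); rewrite /r.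
    have -> : d.+1%:R * (e / (4 * B * d.+1%:R)) = e / 4 / B.
      by field; rewrite ?pnatr_eq0 ?gt_eqF.
    by apply: le_trans; rewrite ler_wpM2r// ler_nat.
  have := HN i Ni; have := g_lipschitz x y; have := gi_lipschitz i x y.
  by rewrite !ler_norml => /andP[? ?] /andP[? ?] /andP[? ?]; lra.
move=> N _ HN; exists N => i Ni p.
have [->|p0] := eqVneq p 0.
  rewrite enorm0 mulr0 (sublinear0 g_sublinear) (sublinear0 (gi_sublinear i)).
  by rewrite subrr normr0.
have np : 0 < `|p| by rewrite normr_gt0.
have := HN i Ni (`|p|^-1 *: p).
rewrite g_sublinear.2 ?invr_ge0// (gi_sublinear i).2 ?invr_ge0//.
rewrite -mulrBr normrM gtr0_norm ?invr_gt0// ler_pdivrMl// mulrC.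
move=> H; rewrite (le_trans (H _))//; last first.
  by rewrite ler_wpM2l ?normr_le_enorm// ltW.
by rewrite /K /= normrZ ger0_norm ?invr_ge0// mulVf ?gt_eqF.
Qed.

(** * One-step recursions for the partial sums *)

(** The restriction [0 < k] reflects that independence is assumed from the second vector on. *)
Let sum_step (f' : 'rV[R]_d -> R) k : (0 < k)%N -> quad_lip f' ->
  expect (fun w => f' (Sum k.+1 w)) =
  expect (fun w => expect (fun w' => f' (Sum k w + Y k w'))).
Proof.
by case: k => // k _ fq; exact: (expect_sum_indep (@Y_indep k) fq).
Qed.

(** A bound at each frozen value [x] of the partial sum is averaged over that sum; the error
    [e * enorm x] costs at most [e] times the first-moment bound [k%:R * B]. *)
Lemma expect_step_le (f f' : 'rV[R]_d -> R) k (e c : R) :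
  (0 < k)%N -> quad_lip f -> quad_lip f' -> 0 <= e ->
  (forall x, expect (fun w => f' (x + Y k w)) <= f x + (e * enorm x + c)) ->
  expect (fun w => f' (Sum k.+1 w)) <=
  expect (fun w => f (Sum k w)) + (e * (k%:R * B) + c).
Proof.
move=> k0 fq fq' e0 H; rewrite sum_step//.
have rS := rv_quad_lip (Sum_rv k) fq.
have rn := rv_scale e (rv_quad_lip (Sum_rv k) (@quad_lip_enorm R d)).
have rnc := rv_add rn (rv_cst S c).
apply: (@le_trans _ _
    (expect (fun w => f (Sum k w) + (e * enorm (Sum k w) + c)))).
  apply: expect_mono => [||w]; last exact: H.
  - exact: rv_add.
  - exact: (rv_quad_lip (Sum_rv k) (quad_lip_expect (Y_rv k) fq')).
rewrite (le_trans (expect_subadd rS rnc))// lerD2l.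
rewrite (le_trans (expect_addc _ rn))// lerD2r expect_pos_hom//.
  by rewrite ler_wpM2l// expect_enorm_sum_le.
exact: (rv_quad_lip (Sum_rv k) (@quad_lip_enorm R d)).
Qed.

(** Lower counterpart of [expect_step_le]; the error stands beside the later sum because
    subadditivity splits only upper bounds. *)
Lemma expect_step_ge (f f' : 'rV[R]_d -> R) k (e c : R) :
  (0 < k)%N -> quad_lip f -> quad_lip f' -> 0 <= e ->
  (forall x, f x <= expect (fun w => f' (x + Y k w)) + (e * enorm x + c)) ->
  expect (fun w => f (Sum k w)) <=
  expect (fun w => f' (Sum k.+1 w)) + (e * (k%:R * B) + c).
Proof.
move=> k0 fq fq' e0 H; rewrite sum_step//.
have rS := rv_quad_lip (Sum_rv k) (quad_lip_expect (Y_rv k) fq').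
have rn := rv_scale e (rv_quad_lip (Sum_rv k) (@quad_lip_enorm R d)).
have rnc := rv_add rn (rv_cst S c).
apply: (@le_trans _ _ (expect (fun w =>
    expect (fun w' => f' (Sum k w + Y k w')) + (e * enorm (Sum k w) + c)))).
  apply: expect_mono => [||w]; last exact: H.
  - exact: rv_add.
  - exact: (rv_quad_lip (Sum_rv k) fq).
rewrite (le_trans (expect_subadd rS rnc))// lerD2l.
rewrite (le_trans (expect_addc _ rn))// lerD2r expect_pos_hom//.
  by rewrite ler_wpM2l// expect_enorm_sum_le.
exact: (rv_quad_lip (Sum_rv k) (@quad_lip_enorm R d)).
Qed.

(** Expand the square of [v + (Y i w - q)]: the cross term contributes twice [gi i v - dot v q], and
    the second moment bounds the rest. *)
Lemma expect_sqr_le i v q :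
  expect (fun w => enorm (v + Y i w - q) ^+ 2) <=
  enorm v ^+ 2 + (2 * (gi i v - dot v q) + (2 * M + 2 * enorm q ^+ 2)).
Proof.
have r1 := rv_scale 2 (rv_dot i v).
have r2 := rvf i (quad_lip_translate (- q) (@quad_lip_sqr_enorm R d)).
have r3 := rv_add r1 r2.
rewrite (_ : (fun w => _) = fun w => 2 * dot (Y i w) v + enorm (Y i w - q) ^+ 2
    + (enorm v ^+ 2 - 2 * dot v q)); last first.
  by apply/funext => w; rewrite -(addrA v) (sqr_enormD v) dotBr (dotC v (Y i w)); ring.
rewrite (le_trans (expect_addc _ r3))//.
have := expect_subadd r1 r2; rewrite expect_pos_hom// -/(gi i v).
by have := expect_sqr_enormB_le i q; lra.
Qed.

(** Solve the same expansion for the cross term: [2 * gi i (- v)] is the expectation of the negative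
    square plus a remainder, which subadditivity splits off. The argument is [- v] because [gi i] is
    not odd in general. *)
Lemma expect_oppr_sqr_ge i v q :
  - enorm v ^+ 2 <= expect (fun w => - enorm (v + Y i w - q) ^+ 2) +
    (2 * (dot (- v) q - gi i (- v)) + (2 * M + 2 * enorm q ^+ 2)).
Proof.
have r2 := rvf i (quad_lip_translate (- q) (@quad_lip_sqr_enorm R d)).
have r3 : rv (fun w => - enorm (v + Y i w - q) ^+ 2).
  have q3 := quad_lipN (quad_lip_translate (v - q) (@quad_lip_sqr_enorm R d)).
  have := rvf i q3; congr rv; apply/funext => w.
  by rewrite addrA (addrC v).
have r4 := rv_add r3 r2.
have gE : 2 * gi i (- v) = expect (fun w => - enorm (v + Y i w - q) ^+ 2
    + enorm (Y i w - q) ^+ 2 + (enorm v ^+ 2 - 2 * dot v q)).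
  rewrite -expect_pos_hom//; congr expect; apply/funext => w.
  by rewrite -(addrA v) (sqr_enormD v) dotBr dotNr (dotC v (Y i w)); ring.
have := expect_addc (enorm v ^+ 2 - 2 * dot v q) r4; rewrite -gE.
have := expect_subadd r3 r2; have := expect_sqr_enormB_le i q.
by rewrite dotNl; lra.
Qed.

(** * Mean-square estimates and convergence in law *)

Section Support.
Variable Gamma : set 'rV[R]_d.
Hypothesis GS : supported_by g Gamma.

Lemma expect_sqdist_growth (e : R) : 0 < e -> exists N, forall n, (N <= n)%N ->
  expect (fun w => sqdist Gamma n (Sum n w)) <= e * n%:R ^+ 2.
Proof.
have [Gamma0 Gb Gc _ _] := GS; have [K K0 GK] := bounded_set_enorm Gb.
pose C := 2 * B + 2 * K + 3 + (2 * M + 2 * K ^+ 2).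
have M0' := ltW M0; have B0' := ltW B0; have K20 := sqr_ge0 K.
have C0 : 0 <= C by rewrite /C !addr_ge0// mulr_ge0.
apply: (quadratic_growth C0) => {}e e0.
have [N HN] := gi_unif_cvg e0; exists N.+1 => k Nk.
have k0 : (0 < k)%N by exact: leq_trans Nk.
(* The 3 is the error 1 of the near-projection [q'] plus twice the error 1 of the near-maximiser
   [q]. *)
pose c := 2 * e * (k%:R * K) + (3 + (2 * M + 2 * K ^+ 2)).
have step x : expect (fun w => sqdist Gamma k.+1 (x + Y k w)) <=
    sqdist Gamma k x + (2 * e * enorm x + c).
  have [q' Gq' xq'] := sqdist_approx Gamma0 k x ltr01.
  pose v := x - k%:R *: q'.
  (* A nearly maximal [q] in the direction [v] makes [gi k v - dot v q] at most [e * enorm v + 1];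
     by convexity [k q' + q] lies in the next dilate of [Gamma]. *)
  have [q Gq vq] := supported_by_approx v GS ltr01.
  have Gz : Gamma ((k%:R / k.+1%:R) *: q' + (1 - k%:R / k.+1%:R) *: q).
    apply: convex_set_combine => //.
    by rewrite ler_pdivrMr// mul1r ler_nat.
  set z := _ + _ in Gz.
  have zE : k.+1%:R *: z = k%:R *: q' + q.
    rewrite /z scalerDr !scalerA mulrBr mulr1 mulrCA divff ?pnatr_eq0// mulr1.
    by rewrite -(natr1 k) addrAC subrr add0r scale1r.
  apply: (@le_trans _ _ (expect (fun w => enorm (v + Y k w - q) ^+ 2))).
    apply: expect_mono => [||w].
    - have qz := quad_lip_translate (v - q) (@quad_lip_sqr_enorm R d).
      have := rvf k qz; congr rv; apply/funext => w.
      by rewrite addrA (addrC v).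
    - have qz := quad_lip_translate x (quad_lip_sqdist Gamma0 K0 GK k.+1).
      by have := rvf k qz; congr rv; apply/funext => w; rewrite addrC.
    - apply: le_trans (sqdist_le _ _ Gz) _; by rewrite zE opprD addrA (addrAC x).
  apply: le_trans (expect_sqr_le k v q) _.
  have := HN k (ltnW Nk) v; rewrite ler_norml => /andP[gv _].
  have := ler_wpM2l (ltW e0) (enorm_sub_dilation GK k x Gq').
  have : enorm q ^+ 2 <= K ^+ 2 by rewrite ler_pXn2r ?nnegrE ?enorm_ge0 ?GK.
  by move: xq' vq gv; rewrite -/v /c; lra.
have e20 : 0 <= 2 * e by rewrite mulr_ge0// ltW.
have := expect_step_le k0 (quad_lip_sqdist Gamma0 K0 GK k)
  (quad_lip_sqdist Gamma0 K0 GK k.+1) e20 step.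
move=> /le_trans; apply; rewrite lerD2l /C /c.
have ek : 0 <= e * k%:R by rewrite mulr_ge0// ltW.
have := mulr_ge0 ek M0'; have := mulr_ge0 ek K20; have := mulr_ge0 ek K0; lra.
Qed.

(** The fixed point [y] serves at every step: [dot (- v) y <= g (- v)] bounds the cross term
    [dot (- v) y - gi k (- v)] by [e * enorm v]. *)
Lemma expect_oppr_sqr_growth y (e : R) : Gamma y -> 0 < e ->
  exists N, forall n, (N <= n)%N ->
  - expect (fun w => - enorm (Sum n w - n%:R *: y) ^+ 2) <= e * n%:R ^+ 2.
Proof.
move=> Gy; have ny0 := enorm_ge0 y; have ny20 := sqr_ge0 (enorm y).
have M0' := ltW M0; have B0' := ltW B0.
pose C := 2 * B + 2 * enorm y + (2 * M + 2 * enorm y ^+ 2).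
have C0 : 0 <= C by rewrite /C !addr_ge0// mulr_ge0.
apply: (quadratic_growth C0) => {}e e0.
have [N HN] := gi_unif_cvg e0; exists N.+1 => k Nk.
have k0 : (0 < k)%N by exact: leq_trans Nk.
pose f k (x : 'rV[R]_d) := - enorm (x - k%:R *: y) ^+ 2.
have fq j : quad_lip (f j).
  by apply: quad_lipN; exact: quad_lip_translate (- _) (@quad_lip_sqr_enorm R d).
pose c := 2 * e * (k%:R * enorm y) + (2 * M + 2 * enorm y ^+ 2).
have step x : f k x <= expect (fun w => f k.+1 (x + Y k w)) +
    (2 * e * enorm x + c).
  pose v := x - k%:R *: y.
  have -> : (fun w => f k.+1 (x + Y k w)) = fun w => - enorm (v + Y k w - y) ^+ 2.
    apply/funext => w; rewrite /f /v; congr (- enorm _ ^+ 2).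
    by rewrite -natr1 scalerDl scale1r opprD addrA (addrAC x).
  apply: le_trans (expect_oppr_sqr_ge k v y) _; rewrite lerD2l.
  have := HN k (ltnW Nk) (- v); rewrite ler_norml enormN => /andP[_ gv].
  have vx : enorm v <= enorm x + k%:R * enorm y.
    by rewrite (le_trans (enormB _ _))// enormZ ger0_norm.
  have := ler_wpM2l (ltW e0) vx; have := supported_by_le (- v) GS Gy.
  by move: gv; rewrite /c; lra.
have e20 : 0 <= 2 * e by rewrite mulr_ge0// ltW.
have := expect_step_ge k0 (fq k) (fq k.+1) e20 step; rewrite /f.
set E := expect _; set E' := expect _ => H.
have ek : 0 <= e * k%:R by rewrite mulr_ge0// ltW.
have := mulr_ge0 ek M0'; have := mulr_ge0 ek ny20; have := mulr_ge0 ek ny0.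
by move: H; rewrite /C /c; lra.
Qed.

Lemma law_of_large_numbers (phi : 'rV[R]_d -> R) y : C_b_Lip phi ->
  Gamma y -> (forall z, Gamma z -> phi z <= phi y) ->
  (fun n => expect (fun w => phi (n%:R^-1 *: Sum n w))) @ \oo --> phi y.
Proof.
move=> [_ [L0 phiL0]] Gy ymax.
pose L := `|L0| + 1; have L_gt0 : 0 < L by rewrite ltr_wpDl.
have phiL x z : phi x <= phi z + L * enorm (x - z).
  rewrite -lerBlDl (le_trans (ler_norm _))// (le_trans (phiL0 x z))//.
  by rewrite ler_wpM2r ?enorm_ge0// (le_trans (ler_norm _))// lerDl.
have phiq := enorm_lip_quad_lip phiL0.
have [Gamma0 Gb _ _ _] := GS; have [K K0 GK] := bounded_set_enorm Gb.
apply/cvgrPdist_le => e e0.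
(* Up to three errors of size [L * t] will add up to at most [e]. *)
pose t := e / (3 * L); have t0 : 0 < t by rewrite divr_gt0// mulr_gt0.
have eE : e = 3 * L * t by rewrite /t; field; rewrite gt_eqF.
move: t t0 eE => t t0 eE.
have [N1 H1] := expect_sqdist_growth (exprn_gt0 2 t0).
have [N2 H2] := expect_oppr_sqr_growth Gy (exprn_gt0 2 t0).
exists (maxn (maxn N1 N2) (Num.bound t^-1)).+1 => // n /=.
rewrite -ltnS ltnS => nN.
have n0 : (0 < n)%N by exact: leq_ltn_trans nN.
have n0' : 0 < n%:R :> R by rewrite ltr0n.
have {}H1 := H1 n (leq_trans (leq_trans (leq_maxl _ _) (leq_maxl _ _)) (ltnW nN)).
have {}H2 := H2 n (leq_trans (leq_trans (leq_maxr _ _) (leq_maxl _ _)) (ltnW nN)).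
have tn : 1 <= t ^+ 2 * n%:R ^+ 2.
  rewrite -exprMn; apply: exprn_ege1; rewrite -ler_pdivrMl// mulr1.
  rewrite (le_trans (ltW (archi_boundP _)))//; first by rewrite invr_ge0 ltW.
  by rewrite ler_nat (leq_trans (leq_maxr _ _) (ltnW nN)).
(* [L] times the coefficient of the squared distance in [enorm_scale_sub_le]. The bounds [H1] and
   [H2] then contribute at most [L * t] each, and [tn] yields [a <= L * t]. *)
pose a := L * (t * n%:R ^+ 2)^-1.
have a0 : 0 < a by rewrite mulr_gt0// invr_gt0 mulr_gt0// exprn_gt0.
have aE : a * (t ^+ 2 * n%:R ^+ 2) = L * t.
  by rewrite /a; field; rewrite !gt_eqF.
have rphi : rv (fun w => phi (n%:R^-1 *: Sum n w)).
  have := rv_quad_lip (Sum_rv n) (quad_lip_comp phiq (enorm_lip_affine n%:R^-1 0)).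
  by congr rv; apply/funext => w /=; rewrite addr0.
have rD := rv_quad_lip (Sum_rv n) (quad_lip_sqdist Gamma0 K0 GK n).
have rQ := rv_quad_lip (Sum_rv n)
  (quad_lipN (quad_lip_translate (- (n%:R *: y)) (@quad_lip_sqr_enorm R d))).
have up : expect (fun w => phi (n%:R^-1 *: Sum n w)) <=
    a * expect (fun w => sqdist Gamma n (Sum n w)) + (a + L * t + phi y).
  rewrite -expect_pos_hom ?(ltW a0)//.
  apply: le_trans (expect_addc _ (rv_scale a rD)).
  apply: expect_mono => //.
    by apply: rv_add; [exact: rv_scale|exact: rv_cst].
  (* Compare with a near-projection [q], where [phi q <= phi y]; its error 1 produces the lone
     summand [a]. *)
  move=> w; have [q Gq Sq] := sqdist_approx Gamma0 n (Sum n w) ltr01.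
  rewrite (le_trans (phiL _ q))//.
  have := ler_wpM2l (ltW L_gt0) (enorm_scale_sub_le (Sum n w) q n0 t0).
  rewrite mulrDr (mulrA L _ (_ ^+ 2)) -/a.
  by have := ler_wpM2l (ltW a0) (ltW Sq); have := ymax q Gq; lra.
have lo : a * expect (fun w => - enorm (Sum n w - n%:R *: y) ^+ 2) +
    (phi y - L * t) <= expect (fun w => phi (n%:R^-1 *: Sum n w)).
  rewrite -expect_pos_hom ?(ltW a0)// -lerBrDr.
  apply: le_trans (expect_addc (- (phi y - L * t)) rphi).
  apply: expect_mono => //.
  - by apply: rv_add => //; exact: rv_cst.
  - exact: rv_scale.
  - move=> w; have := phiL y (n%:R^-1 *: Sum n w); rewrite enormBC.
    have := ler_wpM2l (ltW L_gt0) (enorm_scale_sub_le (Sum n w) y n0 t0).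
    by rewrite mulrDr (mulrA L _ (_ ^+ 2)) -/a; lra.
have h1 := ler_wpM2l (ltW a0) H1.
have h2 := ler_wpM2l (ltW a0) H2.
have h3 := ler_wpM2l (ltW a0) tn.
rewrite aE in h1 h2 h3.
by rewrite ler_norml eE; apply/andP; split; move: up lo; lra.
Qed.

End Support.
End LawOfLargeNumbers.

(* The paper's Y_(i+1) is [Y i]. *)
Theorem corollary5p5 (R : realType) (S : sublinear_space R) (d : nat)
  (Y : nat -> carrier S -> 'rV[R]_d)
  (Y_rv : forall i, random_vector (Y i))
  (Y_indep : forall i, independent_from (Y i.+1) (history Y i.+1))
  (Y_bound : exists M : R, 0 < M /\
     forall i, expect (fun w => enorm (Y i w) ^+ 2) <= M)
  (g : 'rV[R]_d -> R)
  (g_lim : forall p, (fun i => expect (fun w => dot (Y i w) p)) @ \oo --> g p) :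
  (exists! Gamma : set 'rV[R]_d, supported_by g Gamma) /\
  forall Gamma : set 'rV[R]_d, supported_by g Gamma ->
  forall (T : sublinear_space R) (eta : carrier T -> 'rV[R]_d),
    maximal_distributed Gamma eta ->
  forall phi : 'rV[R]_d -> R, C_b_Lip phi ->
    (fun n => expect (fun w => phi (n%:R^-1 *: \sum_(i < n) Y i w))) @ \oo
      --> expect (fun w => phi (eta w)).
Proof.
have [M [M0 YM]] := Y_bound.
have gS : sublinear g by exact (g_sublinear Y_rv g_lim).
split.
  (* Existence is Hahn-Banach; uniqueness is the separation argument, which identifies every
     candidate with [subdiff g]. *)
  exists (subdiff g); split; first exact: subdiff_supported_by.
  by move=> Gamma /supported_by_subdiff ->.
move=> Gamma GS T eta [_ etaP] phi phib; have [y [Gy ymax ->]] := etaP phi phib.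
exact: (law_of_large_numbers Y_rv Y_indep M0 YM g_lim GS phib Gy ymax).
Qed.
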